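(* Let $k\ge1$ and let $B_k$ be the unwrapped butterfly graph with $(k+1)2^k$ vertices. Counted with multiplicity, the eigenvalues of the Laplacian $L(B_k)=D-A$ of $B_k$ are exactly the following: <ul> <li>for $j=0,\dots,k$, the value $4-4\cos\!\left(\frac{\pi j}{k+1}\right)$, each with multiplicity $1$;</li> <li>for each $i=1,\dots,k$ and $j=0,\dots,i-1$, the value $4-4\cos\!\left(\frac{\pi(2j+1)}{2i+1}\right)$, with multiplicity $2^{k-i+1}$;</li> <li>for each $i=1,\dots,k-1$ and $j=1,\dots,i$, the value $4-4\cos\!\left(\frac{j\pi}{i+1}\right)$, with multiplicity $(k-i)2^{k-i-1}$.</li> </ul> Multiplicities of equal values arising from different items or indices are added.
   Context: The unwrapped butterfly graph $B_k$ is the undirected unweighted graph defined recursively. $B_0$ is a single vertex. $B_k$ consists of two disjoint copies of $B_{k-1}$, each with a last column of $2^{k-1}$ vertices $V_{k,j}$ and $V'_{k,j}$ ($j=1,\dots,2^{k-1}$), together with a new column of $2^k$ vertices $V_{k+1,j},V'_{k+1,j}$ ($j=1,\dots,2^{k-1}$). The new column is joined by the edges $\{V_{k,j},V_{k+1,j}\}$, $\{V'_{k,j},V'_{k+1,j}\}$, $\{V_{k,j},V'_{k+1,j}\}$ and $\{V'_{k,j},V_{k+1,j}\}$. Equivalently, $B_k$ has vertex set $\{(c,w): 0\le c\le k,\ w\in\{0,1\}^k\}$, and for each $1\le c\le k$ the vertex $(c-1,w)$ is adjacent to $(c,w)$ and to $(c,w\oplus e_c)$. $D$ is the degree matrix and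 $A$ the adjacency matrix of $B_k$. *)

(* Defs.v *)
From HB Require Import structures.
From mathcomp Require Import all_boot all_order all_algebra.
From mathcomp Require Import reals trigo.
Set Implicit Arguments. Unset Strict Implicit. Unset Printing Implicit Defensive.
Import Order.TTheory GRing.Theory Num.Theory.
Local Open Scope ring_scope.

(* Vertices of the unwrapped butterfly B_k: pairs (c, w), 0 <= c <= k,
   w in {0,1}^k (bits indexed 0..k-1; e_c of the paper is bit c-1). *)
Definition bvert (k : nat) := ('I_k.+1 * {ffun 'I_k -> bool})%type.

Definition flipbit (k : nat) (w : {ffun 'I_k -> bool}) (i : 'I_k) : {ffun 'I_k -> bool} :=
  [ffun j => if j == i then ~~ w j else w j].

(* directed "forward" edge (c-1, w) -> (c, w) or (c, w xor e_c), 1 <= c <= k;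
   here c1 = c-1 and the flipped bit has 0-based index c1 *)
Definition bfwd (k : nat) (u v : bvert k) : bool :=
  (val v.1 == (val u.1).+1) &&
  [exists i : 'I_k, (val i == val u.1) && ((v.2 == u.2) || (v.2 == flipbit u.2 i))].

Definition badj (k : nat) (u v : bvert k) : bool := bfwd u v || bfwd v u.

Definition bdeg (k : nat) (u : bvert k) : nat := #|[set v | badj u v]|.

Definition blaplacian (R : realType) (k : nat) : 'M[R]_#|{: bvert k}| :=
  \matrix_(i, j)
    (let u := enum_val i in let v := enum_val j in
     (if u == v then (bdeg u)%:R else 0) - (badj u v)%:R).

Definition bspec (R : realType) (k : nat) : seq R :=
  [seq 4 - 4 * cos (pi * j%:R / (k.+1)%:R) | j <- iota 0 k.+1]
  ++ flatten [seq flatten [seq nseq (2 ^ (k - i + 1))%N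
                    (4 - 4 * cos (pi * (2 * j + 1)%N%:R / (2 * i + 1)%N%:R))
                  | j <- iota 0 i] | i <- iota 1 k]
  ++ flatten [seq flatten [seq nseq ((k - i) * 2 ^ (k - i - 1))%N
                    (4 - 4 * cos (j%:R * pi / (i.+1)%:R))
                  | j <- iota 1 i] | i <- iota 1 (k - 1)%N].

(* Main.v *)
Require Import Defs.
From HB Require Import structures.
From mathcomp Require Import all_boot all_order all_algebra.
From mathcomp Require Import reals trigo.
From mathcomp Require Import perm ring zify lra.
Import Order.TTheory GRing.Theory Num.Theory.
Set Implicit Arguments. Unset Strict Implicit. Unset Printing Implicit Defensive.
Local Open Scope ring_scope.

(** The Walsh transform in the word coordinate turns the edges between columns
    [c] and [c+1] into multiplication by [1 + (-1)^(s_c)], i.e. by [2] or [0].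
    Hence the Laplacian is similar to a direct sum, over [s] in [{0,1}^k], of
    tridiagonal matrices with diagonal [2,4,...,4,2], each of which splits into
    path blocks at the ones of [s].  The blocks have as characteristic polynomials
    Chebyshev-like sequences: both ends of degree [2] (only for [s = 0]), one end
    of degree [2], or none, and their roots are the cosines of the statement.
    Reading [s] bit by bit, each completed block contributes a factor and the
    product over all [s] satisfies a recursion that yields the multiplicities. *)

(** * Determinants of block-diagonal matrices and of matrices indexed by a finite type *)

Lemma det_castmx (A : comNzRingType) m n (e : m = n) (M : 'M[A]_m) :
  \det (castmx (e, e) M) = \det M.
Proof. by case: n / e; rewrite castmx_id. Qed.

Lemma det_mxdiag (A : comNzRingType) n (p_ : 'I_n -> nat)
    (B : forall i, 'M[A]_(p_ i)) :
  \det (\mxdiag_i B i) = \prod_i \det (B i).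
Proof.
elim: n p_ B => [|n IH] p_ B.
  (* The empty sum of sizes equals 0 only propositionally, so the size is generalised before
     substitution. *)
  rewrite [RHS]big_ord0; move: (\mxdiag_i B i) (big_ord0 0%N addn xpredT p_).
  by move: (\sum_i p_ i)%N => m M m0; subst m; apply: det_mx00.
by rewrite mxdiag_recl det_castmx det_lblock IH big_ord_recl.
Qed.

(** Rows and columns undergo the same permutation, so its sign enters squared. *)
Lemma det_mxsub_bij (A : comNzRingType) m n (g : 'I_n -> 'I_m) (M : 'M[A]_m) :
  bijective g -> \det (mxsub g g M) = \det M.
Proof.
move=> bg; have e : n = m by have := bij_eq_card bg; rewrite !card_ord.
case: m / e g M bg => g M /bij_inj ig.
have -> : mxsub g g M = row_perm (perm ig) (col_perm (perm ig) M).
  by apply/matrixP => i j; rewrite !mxE !permE.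
rewrite row_permE col_permE !det_mulmx !det_perm odd_permV.
by rewrite mulrCA mulrA -mulrA -expr2 sqrr_sign mulr1.
Qed.

(** Indexing by a finite type lets the vertices stay pairs; by [fdet_reindex] any enumeration gives
    the same value. *)
Definition fdet (A : comNzRingType) (T : finType) (f : T -> T -> A) : A :=
  \det (\matrix_(i < #|T|, j < #|T|) f (enum_val i) (enum_val j)).

Lemma fdet_reindex (A : comNzRingType) (T : finType) (f : T -> T -> A) n
    (h : 'I_n -> T) :
  bijective h -> fdet f = \det (\matrix_(i, j) f (h i) (h j)).
Proof.
move=> bh; have bg : bijective (enum_rank \o h).
  by apply: bij_comp => //; apply: enum_rank_bij.
rewrite /fdet -(det_mxsub_bij _ bg); congr (\det _).
by apply/matrixP => i j; rewrite !mxE /= !enum_rankK.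
Qed.

(** Listing the pairs so that those with equal second component are consecutive makes the matrix
    block diagonal. *)
Lemma fdet_block (A : comNzRingType) (S : finType) n (B : S -> 'M[A]_n) :
  fdet (fun u v : 'I_n * S => if u.2 == v.2 then B u.2 u.1 v.1 else 0) =
  \prod_s \det (B s).
Proof.
pose p_ := fun _ : 'I_#|S| => n.
pose h (i : 'I_(\sum_i p_ i)) : 'I_n * S :=
  (tagnat.sig2 i, enum_val (tagnat.sig1 i)).
have bh : bijective h.
  exists (fun u => @tagnat.Rank _ p_ (enum_rank u.2) u.1) => [i|[c s]].
    by rewrite /h /= enum_valK tagnat.sig2K.
  rewrite /h /= tagnat.Rank1K enum_rankK; congr (_, _).
  by apply: val_inj; rewrite /= tagnat.Rank2K.
rewrite (fdet_reindex _ bh) (reindex (@enum_val S predT)) /=; last first.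
  by exists enum_rank => i _; rewrite ?enum_valK ?enum_rankK.
rewrite -(det_mxdiag (p_ := p_)); congr (\det _); apply/matrixP => i j.
rewrite !mxE /= (inj_eq enum_val_inj).
by case: eqP => // _; rewrite ?conform_mx_id ?mxE.
Qed.

Lemma fdet_mul (A : comNzRingType) (T : finType) (f g : T -> T -> A) :
  fdet (fun u v => \sum_w f u w * g w v) = fdet f * fdet g.
Proof.
rewrite /fdet -det_mulmx; congr (\det _); apply/matrixP => i j; rewrite !mxE.
rewrite (reindex (@enum_val T predT)) /=; last first.
  by exists enum_rank => k _; rewrite ?enum_valK ?enum_rankK.
by apply: eq_bigr => k _; rewrite !mxE.
Qed.

Lemma eq_fdet (A : comNzRingType) (T : finType) (f g : T -> T -> A) :
  f =2 g -> fdet f = fdet g.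
Proof. by move=> e; congr (\det _); apply/matrixP => i j; rewrite !mxE. Qed.

Lemma fdet_scalar (A : comNzRingType) (T : finType) (a : A) :
  fdet (fun u v : T => if u == v then a else 0) = a ^+ #|T|.
Proof.
rewrite -det_scalar; congr (\det _); apply/matrixP => i j; rewrite !mxE.
by rewrite (inj_eq enum_val_inj); case: eqP.
Qed.

(** * Tridiagonal determinants *)

Section Tridiagonal.
Variable A : comNzRingType.
Implicit Types d b : nat -> A.

Definition tridiag_mx n d b : 'M[A]_n :=
  \matrix_(i, j) if val i == val j then d i
                 else if val j == (val i).+1 then b i
                 else if val i == (val j).+1 then b j else 0.

(** Expand along the first row; the minor of its second entry has a first column whose only nonzero
    entry is [b 0]. *)
Lemma det_tridiagS n d b :
  \det (tridiag_mx n.+1 d b) =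
  d 0%N * \det (tridiag_mx n (d \o S) (b \o S))
  - (if n is m.+1 then
       b 0%N ^+ 2 * \det (tridiag_mx m (d \o S \o S) (b \o S \o S)) else 0).
Proof.
rewrite (expand_det_row _ ord0) big_ord_recl mxE /=; congr (_ * _ + _).
  rewrite /cofactor addn0 expr0 mul1r; congr (\det _).
  by apply/matrixP => i j; rewrite !mxE /= /bump /= !add1n !eqSS.
case: n => [|n]; first by rewrite big_ord0 oppr0.
rewrite big_ord_recl big1 ?addr0 => [|i _]; last first.
  by rewrite mxE /= mul0r.
rewrite mxE /= /cofactor /= (expand_det_col _ ord0) big_ord_recl big1 ?addr0; last first.
  by move=> i _; rewrite !mxE /= mul0r.
rewrite !mxE /= /cofactor /bump /= expr1 expr0 mul1r expr2 mulN1r mulrN mulrA.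
congr (- (_ * \det _)).
by apply/matrixP => i j; rewrite !mxE /= /bump /= !add1n !eqSS.
Qed.
End Tridiagonal.

(** Words are split at their last letter because [foldr] consumes that letter first. *)
Lemma big_tuple_rcons (A : comNzRingType) (T : finType) m (F : seq T -> A) :
  \prod_(t : m.+1.-tuple T) F t =
  \prod_(b : T) \prod_(t : m.-tuple T) F (rcons t b).
Proof.
rewrite exchange_big pair_bigA.
pose h (u : m.-tuple T * T) := [tuple of rcons u.1 u.2].
have ih : injective h.
  move=> [t b] [t' b'] /(congr1 val) /= /rcons_inj[e ->].
  by congr (_, _); apply: val_inj.
have bh : bijective h.
  by apply: inj_card_bij ih _; rewrite card_prod !card_tuple expnSr.
by rewrite (reindex h) //=; apply: onW_bij.
Qed.

(** * Path determinants and their product over all words *)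

Section PathPolynomials.
Variable A : comNzRingType.
Variable x : A.

(* [v] holds the determinants of a path matrix with and without its last vertex;
   [path_step b v] appends a vertex of degree 4, cutting the new edge if [b]. *)
Definition path_step (b : bool) (v : A * A) : A * A :=
  ((x - 4) * v.1 - (if b then 0 else 4) * v.2, v.1).

(* Lowers the degree of the last vertex from 4 to 2. *)
Definition path_end (v : A * A) : A := v.1 + 2 * v.2.

(** Rescaled Chebyshev polynomials: at x = 4 - 4 cos t, the choice a = x - 4 gives (-2)^n U_n(cos t)
    (second kind) and a = x - 2 gives (-2)^n V_n(cos t) (third kind). *)
Fixpoint path_seq (a : A) n : A :=
  match n with
  | 0 => 1
  | S n' => match n' with
            | 0 => a
            | S n'' => (x - 4) * path_seq a n' - 4 * path_seq a n''
            end
  end.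

Lemma path_seqSS a n :
  path_seq a n.+2 = (x - 4) * path_seq a n.+1 - 4 * path_seq a n.
Proof. by []. Qed.
Local Arguments path_seq : simpl never.

(** Both sides are the determinant of a path with one end of degree 2, built from opposite ends.
    They obey the same recurrence, so the induction carries two consecutive indices. *)
Lemma path_seq_end n :
  path_seq (x - 4) n.+1 + 2 * path_seq (x - 4) n = path_seq (x - 2) n.+1.
Proof.
suff [] : path_seq (x - 4) n.+1 + 2 * path_seq (x - 4) n = path_seq (x - 2) n.+1
  /\ path_seq (x - 4) n.+2 + 2 * path_seq (x - 4) n.+1 = path_seq (x - 2) n.+2 by [].
elim: n => [|n [IH1 IH2]]; first by split; rewrite /path_seq; ring.
split=> //; rewrite (path_seqSS (x - 2)) -IH2 -IH1.
by rewrite !(path_seqSS _ n.+1) !(path_seqSS _ n); ring.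
Qed.

Local Notation bb s := (fun i => if nth false s i then 0 else 2 : A).
Local Notation dd s := (fun i => x - 4 + (if i == size s then 2 else 0) : A).

(** The seed (x - 2, 1) is the last vertex alone; each bit, read from the right, puts one more
    vertex in front, as in [det_tridiagS]. *)
Lemma det_tridiag_path (s : seq bool) :
  let v := foldr path_step (x - 2, 1) s in
  v.1 = \det (tridiag_mx (size s).+1 (dd s) (bb s)) /\
  v.2 = \det (tridiag_mx (size s) (dd s \o S) (bb s \o S)).
Proof.
elim: s => [|b s [IH1 IH2]] /=.
  by rewrite det_tridiagS /= !det_mx00; split=> //; ring.
split=> //; rewrite IH1 IH2 [in RHS]det_tridiagS.
congr (_ * _ - _ * _) => //=; first by rewrite addr0.
by case: b; ring.
Qed.

(** The determinant is affine in its top left entry, with slope the minor [v.2] of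
    [det_tridiag_path]; raising that entry by 2 is [path_end]. *)
Lemma det_tridiag_path_end (s : seq bool) :
  \det (tridiag_mx (size s).+1
    (fun i => (if i == 0%N then x - 2 else x - 4) + (if i == size s then 2 else 0))
    (bb s)) = path_end (foldr path_step (x - 2, 1) s).
Proof.
have [e1 e2] := det_tridiag_path s.
rewrite /path_end e1 e2 !det_tridiagS.
(* After the shift by [S] the test [i == 0] is false, so both expansions share their minors by
   conversion. *)
transitivity ((x - 2 + (if 0%N == size s then 2 else 0)) *
    \det (tridiag_mx (size s) (dd s \o S) (bb s \o S)) -
  (if size s is m.+1 then bb s 0%N ^+ 2 *
     \det (tridiag_mx m (dd s \o S \o S) (bb s \o S \o S)) else 0)) => //.
set D := \det _; set M := (X in _ - X); rewrite -/M.
rewrite [in RHS](_ : x - 4 = x - 2 - 2); last by ring.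
by move: D M; case: ifP => _ D M; ring.
Qed.

Definition path_prod m (v : A * A) : A :=
  \prod_(t : m.-tuple bool) path_end (foldr path_step v t).

Lemma path_prod0 v : path_prod 0 v = path_end v.
Proof.
rewrite /path_prod (bigD1 [tuple]) //= big1 ?mulr1 // => t /eqP[].
by rewrite tuple0.
Qed.

Lemma path_prodS m v :
  path_prod m.+1 v = path_prod m (path_step false v) * path_prod m (path_step true v).
Proof.
rewrite /path_prod (big_tuple_rcons _ (fun t => path_end (foldr path_step v t))).
rewrite big_bool /= mulrC.
by congr (_ * _); apply: eq_bigr => t _; rewrite foldr_rcons.
Qed.

(** [path_step] and [path_end] are linear, so each of the 2^m words contributes one factor c. *)
Lemma path_prodZ m c p q :
  path_prod m (c * p, c * q) = c ^+ (2 ^ m) * path_prod m (p, q).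
Proof.
elim: m p q => [|m IH] p q; first by rewrite !path_prod0 /path_end /=; ring.
rewrite !path_prodS /path_step /= !mul0r !subr0 !(mulrCA _ c) -mulrBr !IH.
by rewrite expnS mul2n -addnn exprD; ring.
Qed.

Local Notation U := (path_seq (x - 4)).
Local Notation E := (path_seq (x - 2)).
(* After a cut, the state is proportional to [(x - 4, 1)]: the block length
   restarts at 1. *)
Definition restart_prod m := path_prod m (x - 4, 1).

(** Group the words by the first cut read. A cut after t uncut letters completes a block of n + t +
    1 vertices, whose determinant factors out of all 2^(m - t - 1) continuations; the word without
    cuts gives the leading factor. *)
Lemma path_prod_seq a m n :
  path_prod m (path_seq a n.+1, path_seq a n) =
  (path_seq a (n + m).+1 + 2 * path_seq a (n + m)) *
  \prod_(0 <= t < m)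
    (path_seq a (n + t).+1 ^+ (2 ^ (m - t.+1)) * restart_prod (m - t.+1)).
Proof.
elim: m n => [|m IH] n; first by rewrite path_prod0 big_geq // mulr1 addn0.
rewrite path_prodS big_nat_recl // subSS subn0 addn0.
rewrite /path_step /= -/(path_seq a n.+2) mul0r subr0.
have -> : ((x - 4) * path_seq a n.+1, path_seq a n.+1) =
  (path_seq a n.+1 * (x - 4), path_seq a n.+1 * 1) by rewrite mulr1 mulrC.
rewrite path_prodZ -/(restart_prod m) IH addSnnS.
rewrite -mulrA; congr (_ * _); rewrite mulrC; congr (_ * _).
by apply: eq_bigr => t _; rewrite addSnnS subSS.
Qed.

Definition closed_prod m := \prod_(0 <= t < m) restart_prod t.

Lemma path_prod_seqE a m :
  path_prod m (a, 1) =
  (path_seq a m.+1 + 2 * path_seq a m) *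
  (\prod_(0 <= t < m) path_seq a t.+1 ^+ (2 ^ (m - t.+1)) * closed_prod m).
Proof.
rewrite (path_prod_seq a m 0) add0n big_split /=; congr (_ * (_ * _)).
by rewrite /closed_prod [RHS]big_nat_rev.
Qed.

(** [restart_prod m] itself contains [closed_prod m], so passing to m + 1 squares [closed_prod m]
    and multiplies it by new E and U factors. Doubling e 2^(e-1) and adding 2^e gives (e+1) 2^e, the
    source of the linear factor in the exponent of U. *)
Lemma closed_prodE m : closed_prod m =
  \prod_(0 <= t < m) E t.+1 ^+ (2 ^ (m - t.+1)) *
  \prod_(0 <= t < m) U t.+1 ^+ ((m - t.+1) * 2 ^ (m - t.+2)).
Proof.
elim: m => [|m IH]; first by rewrite /closed_prod !big_geq ?mulr1.
have -> : closed_prod m.+1 =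
    closed_prod m ^+ 2 * (E m.+1 * \prod_(0 <= t < m) U t.+1 ^+ (2 ^ (m - t.+1))).
  rewrite {1}/closed_prod big_nat_recr //= -/(closed_prod m) /restart_prod.
  rewrite (path_prod_seqE (x - 4)) path_seq_end.
  by move: (closed_prod m) (\prod_(0 <= t < m) _) (path_seq _ _) => a b c; ring.
rewrite !big_nat_recr //= subSS subnn mul0n expr0 mulr1 expn0 expr1.
rewrite IH exprMn -!prodrXl -!mulrA.
rewrite [X in _ * X]mulrCA -big_split /=; congr (_ * (_ * _)).
  apply: eq_big_nat => t /andP[_ lt_tm]; rewrite -exprM; congr (_ ^+ _).
  by rewrite -expnSr; congr (_ ^ _)%N; lia.
apply: eq_big_nat => t /andP[_ lt_tm]; rewrite -exprM -exprD; congr (_ ^+ _).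
(* At t = m - 1 the subtraction [m - t.+2] truncates, but its power is multiplied by 0. *)
rewrite !subSS; have [e|lt] := eqVneq (m - t.+1)%N 0%N.
  by rewrite e; have -> : (m - t = 1)%N by lia.
have -> : (m - t = (m - t.+2).+2)%N by lia.
have -> : (m - t.+1 = (m - t.+2).+1)%N by lia.
by rewrite !expnS; lia.
Qed.

(** Blocks with one end of degree 2 occur at either end of the path, once through the seed and once
    through [closed_prod], hence the doubled exponent of E. *)
Lemma path_prod_all m : path_prod m (x - 2, 1) =
  (E m.+1 + 2 * E m) *
  \prod_(0 <= t < m) E t.+1 ^+ (2 ^ (m - t.+1)).*2 *
  \prod_(0 <= t < m) U t.+1 ^+ ((m - t.+1) * 2 ^ (m - t.+2)).
Proof.
rewrite path_prod_seqE closed_prodE !mulrA; congr (_ * _).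
by rewrite -!mulrA -big_split /=; under eq_bigr do rewrite -exprD addnn.
Qed.

End PathPolynomials.
Arguments path_seq {A} x a n : simpl never.

(** * Roots of the path polynomials *)

Section Roots.
Variable R : realType.
Implicit Types (t y : R) (n : nat).

Lemma horner_path_seq (a : {poly R}) y n :
  (path_seq 'X a n).[y] = path_seq y a.[y] n.
Proof.
suff [] : (path_seq 'X a n).[y] = path_seq y a.[y] n /\
  (path_seq 'X a n.+1).[y] = path_seq y a.[y] n.+1 by [].
elim: n => [|n [IH1 IH2]]; first by rewrite /path_seq hornerE.
split=> //; rewrite !path_seqSS -IH1 -IH2 -[4]/(4%:R) -!polyC_natr.
by rewrite !hornerE.
Qed.

Lemma path_seq_monic (c : R) n :
  path_seq 'X ('X - c%:P) n \is monic /\ size (path_seq 'X ('X - c%:P) n) = n.+1.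
Proof.
pose p := path_seq 'X ('X - c%:P).
suff [] : (p n \is monic /\ size (p n) = n.+1) /\
  (p n.+1 \is monic /\ size (p n.+1) = n.+2) by [].
elim: n => [|n [[m1 s1] [m2 s2]]].
  by rewrite /p /path_seq monic1 size_poly1 monicXsubC size_XsubC.
split=> //; rewrite /p path_seqSS -/p -[4]/(4%:R) -polyC_natr.
have sz : size (('X - 4%:R%:P) * p n.+1) = n.+3.
  by rewrite size_monicM ?monicXsubC ?monic_neq0 // size_XsubC s2.
have lt : (size (- (4%:R%:P * p n))%R < size (('X - 4%:R%:P) * p n.+1)%R)%N.
  rewrite sz size_polyN mul_polyC ltnS (leq_trans (size_scale_leq _ _)) //.
  by rewrite s1.
split; last by rewrite size_polyDl.
by rewrite monicE lead_coefDl // -monicE monicMr ?monicXsubC.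
Qed.

Lemma monic_factor (p : {poly R}) (rs : seq R) :
  p \is monic -> size p = (size rs).+1 -> all (root p) rs -> uniq rs ->
  p = \prod_(z <- rs) ('X - z%:P).
Proof.
move=> mp sp rp urs; have := all_roots_prod_XsubC sp rp.
by rewrite uniq_rootsE (monicP mp) scale1r; apply.
Qed.

Lemma uniq_spec (f : nat -> R) (s : seq nat) :
  uniq s -> {in s &, injective f} -> {in s, forall j, 0 <= f j <= pi} ->
  uniq [seq 4 - 4 * cos (f j) | j <- s].
Proof.
move=> us fi fb; rewrite map_inj_in_uniq // => i j si sj e.
apply: fi => //; apply: cos_inj; rewrite ?in_itv /= ?fb //.
by move: e; lra.
Qed.

(** The recurrence is sin((n+3)t) + sin((n+1)t) = 2 cos t sin((n+2)t), scaled by powers of -2. *)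
Lemma sin_path_seq t n :
  sin t * path_seq (4 - 4 * cos t) (4 - 4 * cos t - 4) n =
  (- 2) ^+ n * sin (n.+1%:R * t).
Proof.
set y := 4 - _.
suff [] : sin t * path_seq y (y - 4) n = (- 2) ^+ n * sin (n.+1%:R * t) /\
  sin t * path_seq y (y - 4) n.+1 = (- 2) ^+ n.+1 * sin (n.+2%:R * t) by [].
elim: n => [|n [IH1 IH2]].
  rewrite /path_seq /y expr0 expr1 !mul1r; split; first by rewrite mulr1.
  by rewrite [2 * t]mulr_natl sin_mulr2n mulr2n; ring.
split=> //; rewrite path_seqSS.
transitivity ((y - 4) * (sin t * path_seq y (y - 4) n.+1) -
  4 * (sin t * path_seq y (y - 4) n)); first by ring.
rewrite IH1 IH2 /y.
have -> : n.+3%:R * t = n.+2%:R * t + t by rewrite -(natr1 n.+2); ring.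
have -> : n.+1%:R * t = n.+2%:R * t - t by rewrite -(natr1 n.+1); ring.
by rewrite sinB sinD !exprS; ring.
Qed.

(** Here t is half the spectral angle, which keeps the multiples of t integral. *)
Lemma cos_path_seq t n :
  cos t * path_seq (4 - 4 * cos (2 * t)) (4 - 4 * cos (2 * t) - 2) n =
  (- 2) ^+ n * cos (n.*2.+1%:R * t).
Proof.
set y := 4 - _.
have e2 : cos (2 * t) = 2 * cos t ^+ 2 - 1.
  by rewrite [2 * t]mulr_natl cos_mulr2n; ring.
suff [] : cos t * path_seq y (y - 2) n = (- 2) ^+ n * cos (n.*2.+1%:R * t) /\
  cos t * path_seq y (y - 2) n.+1 = (- 2) ^+ n.+1 * cos (n.+1.*2.+1%:R * t) by [].
elim: n => [|n [IH1 IH2]].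
  rewrite /path_seq /y expr0 expr1 !mul1r; split; first by rewrite mulr1.
  have -> : 3%:R * t = 2 * t + t by ring.
  rewrite cosD e2 [2 * t]mulr_natl sin_mulr2n.
  have -> : cos t * sin t *+ 2 * sin t = 2 * cos t * (1 - cos t ^+ 2).
    by rewrite -sin2cos2; ring.
  by ring.
split=> //; rewrite path_seqSS.
transitivity ((y - 4) * (cos t * path_seq y (y - 2) n.+1) -
  4 * (cos t * path_seq y (y - 2) n)); first by ring.
rewrite IH1 IH2 /y.
have -> : n.+2.*2.+1%:R * t = n.+1.*2.+1%:R * t + 2 * t.
  by rewrite !doubleS -!natr1; ring.
have -> : n.*2.+1%:R * t = n.+1.*2.+1%:R * t - 2 * t.
  by rewrite !doubleS -!natr1; ring.
by rewrite cosB cosD !exprS; ring.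
Qed.

Lemma sin_natpi n : sin (n%:R * pi) = 0 :> R.
Proof.
elim: n => [|n IH]; first by rewrite mul0r sin0.
by rewrite -natr1 mulrDl mul1r sinDpi IH oppr0.
Qed.

Lemma cos_natpi_half n : cos (n.*2.+1%:R * (pi / 2)) = 0 :> R.
Proof.
have -> : n.*2.+1%:R * (pi / 2) = n%:R * pi + pi / 2 :> R.
  by rewrite -natr1 -muln2 natrM; field.
by rewrite cosDpihalf sin_natpi oppr0.
Qed.

(** The angles t = j pi/(n+1) lie strictly between 0 and pi, so sin t can be cancelled in
    [sin_path_seq]; they give n distinct roots of a monic polynomial of degree n. *)
Lemma path_seq_factor_mid n :
  path_seq 'X ('X - 4) n =
  \prod_(j <- iota 1 n) ('X - (4 - 4 * cos (j%:R * pi / n.+1%:R : R))%:P).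
Proof.
have [mn sn] := path_seq_monic 4 n.
have e4 : 4%:P = 4 :> {poly R} by rewrite polyC_natr.
rewrite e4 in mn sn.
rewrite -(big_map (fun j => 4 - 4 * cos (j%:R * pi / n.+1%:R : R)) xpredT
  (fun z => 'X - z%:P)).
have n0 : 0 < n.+1%:R :> R by rewrite ltr0n.
have pos := @pi_gt0 R.
have bd j : j \in iota 1 n ->
    0 < j%:R * pi / n.+1%:R :> R /\ j%:R * pi / n.+1%:R < pi :> R.
  rewrite mem_iota add1n => /andP[j1 jn].
  split; first by rewrite divr_gt0 ?mulr_gt0 ?ltr0n.
  by rewrite ltr_pdivrMr // mulrC ltr_pM2l // ltr_nat.
apply: monic_factor => //; first by rewrite size_map size_iota.
  apply/allP => _ /mapP[j /bd[j0 jp] ->]; set t := _ / _ in j0 jp *.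
  have st : sin t != 0 by rewrite gt_eqF // sin_gt0_pi // j0.
  rewrite rootE horner_path_seq -(mulrI_eq0 _ (mulfI st)) -e4 !hornerE sin_path_seq.
  have -> : n.+1%:R * t = j%:R * pi by rewrite mulrC /t divfK ?gt_eqF.
  by rewrite sin_natpi mulr0.
apply: uniq_spec; first exact: iota_uniq.
  move=> i j _ _ /(mulIf _); rewrite invr_eq0 gt_eqF // => /(_ isT).
  by move/(mulIf _); rewrite gt_eqF // => /(_ isT) /eqP; rewrite eqr_nat => /eqP.
by move=> j /bd[/ltW -> /ltW ->].
Qed.

(** Same scheme with [cos_path_seq]: t/2 stays below pi/2, so cos(t/2) can be cancelled. *)
Lemma path_seq_factor_end n :
  path_seq 'X ('X - 2) n =
  \prod_(j <- iota 0 n)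
    ('X - (4 - 4 * cos (pi * (2 * j + 1)%N%:R / (2 * n + 1)%N%:R : R))%:P).
Proof.
have [mn sn] := path_seq_monic 2 n.
have e2 : 2%:P = 2 :> {poly R} by rewrite polyC_natr.
rewrite e2 in mn sn.
rewrite -(big_map
  (fun j => 4 - 4 * cos (pi * (2 * j + 1)%N%:R / (2 * n + 1)%N%:R : R)) xpredT
  (fun z => 'X - z%:P)).
have n0 : 0 < (2 * n + 1)%N%:R :> R by rewrite ltr0n addn1.
have pos := @pi_gt0 R.
have bd j : j \in iota 0 n -> 0 < pi * (2 * j + 1)%N%:R / (2 * n + 1)%N%:R :> R
     /\ pi * (2 * j + 1)%N%:R / (2 * n + 1)%N%:R < pi :> R.
  rewrite mem_iota add0n => /andP[_ jn].
  split; first by rewrite divr_gt0 ?mulr_gt0 ?ltr0n ?addn1.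
  by rewrite ltr_pdivrMr // ltr_pM2l // ltr_nat; lia.
apply: monic_factor => //; first by rewrite size_map size_iota.
  apply/allP => _ /mapP[j /bd[j0 jp] ->]; set t := _ / _ in j0 jp *.
  have ct : cos (t / 2) != 0.
    by rewrite gt_eqF // cos_gt0_pihalf //; apply/andP; split; lra.
  have et : t = 2 * (t / 2) by field.
  rewrite rootE horner_path_seq -(mulrI_eq0 _ (mulfI ct)) -e2 !hornerE.
  have := cos_path_seq (t / 2) n; rewrite -et => ->.
  have -> : n.*2.+1%:R * (t / 2) = j.*2.+1%:R * (pi / 2).
    have e m : (m.*2.+1 = 2 * m + 1)%N by lia.
    rewrite !e mulrA [_ * t]mulrC /t.
    by rewrite divfK ?gt_eqF // -mulrA mulrCA.
  by rewrite cos_natpi_half mulr0.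
apply: uniq_spec; first exact: iota_uniq.
  move=> i j _ _ /(mulIf _); rewrite invr_eq0 gt_eqF // => /(_ isT).
  by move/(mulfI _); rewrite gt_eqF // => /(_ isT) /eqP; rewrite eqr_nat => /eqP; lia.
by move=> j /bd[/ltW -> /ltW ->].
Qed.

(** Times cos(t/2), the value is (-2)^(n+1) (cos((n+1)t + t/2) - cos((n+1)t - t/2)), which has the
    factor sin((n+1)t). Cancelling a cosine rather than a sine admits j = 0, the eigenvalue 0. *)
Lemma path_seq_factor_full n :
  path_seq 'X ('X - 2) n.+1 + 2 * path_seq 'X ('X - 2) n =
  \prod_(j <- iota 0 n.+1) ('X - (4 - 4 * cos (pi * j%:R / n.+1%:R : R))%:P).
Proof.
have [mn sn] := path_seq_monic 2 n.
have [mn1 sn1] := path_seq_monic 2 n.+1.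
have e2 : 2%:P = 2 :> {poly R} by rewrite polyC_natr.
rewrite e2 in mn sn mn1 sn1.
rewrite -(big_map (fun j => 4 - 4 * cos (pi * j%:R / n.+1%:R : R)) xpredT
  (fun z => 'X - z%:P)).
have n0 : 0 < n.+1%:R :> R by rewrite ltr0n.
have pos := @pi_gt0 R.
have bd j : j \in iota 0 n.+1 ->
    0 <= pi * j%:R / n.+1%:R :> R /\ pi * j%:R / n.+1%:R < pi :> R.
  rewrite mem_iota add0n => /andP[_ jn].
  split; first by rewrite divr_ge0 ?mulr_ge0 ?ler0n ?ltW.
  by rewrite ltr_pdivrMr // ltr_pM2l // ltr_nat.
have lt : (size (2 * path_seq 'X ('X - 2 : {poly R}) n)%R <
    size (path_seq 'X ('X - 2 : {poly R})%R n.+1))%N.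
  rewrite -{1}e2 mul_polyC sn1 ltnS (leq_trans (size_scale_leq _ _)) //.
  by rewrite sn.
apply: monic_factor => //.
- by rewrite monicE lead_coefDl // -monicE.
- by rewrite size_polyDl // size_map size_iota.
- apply/allP => _ /mapP[j /bd[j0 jp] ->]; set t := _ / _ in j0 jp *.
  have ct : cos (t / 2) != 0.
    by rewrite gt_eqF // cos_gt0_pihalf //; apply/andP; split; lra.
  have et : t = 2 * (t / 2) by field.
  rewrite rootE -(mulrI_eq0 _ (mulfI ct)) -{2}e2 hornerD hornerM hornerC.
  rewrite !horner_path_seq -e2 !hornerE mulrDr mulrCA.
  have := cos_path_seq (t / 2) n; rewrite -et => ->.
  have := cos_path_seq (t / 2) n.+1; rewrite -et => ->.
  have -> : n.+1.*2.+1%:R * (t / 2) = n.+1%:R * t + t / 2.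
    by rewrite -natr1 -muln2 natrM; field.
  have -> : n.*2.+1%:R * (t / 2) = n.+1%:R * t - t / 2.
    by rewrite -[n.*2.+1%:R]natr1 -[n.+1%:R]natr1 -muln2 natrM; field.
  have -> : n.+1%:R * t = j%:R * pi by rewrite mulrC /t divfK ?gt_eqF // mulrC.
  by rewrite cosB cosD sin_natpi exprS; apply/eqP; ring.
apply: uniq_spec; first exact: iota_uniq.
  move=> i j _ _ /(mulIf _); rewrite invr_eq0 gt_eqF // => /(_ isT).
  by move/(mulfI _); rewrite gt_eqF // => /(_ isT) /eqP; rewrite eqr_nat => /eqP.
by move=> j /bd[-> /ltW ->].
Qed.

End Roots.

Lemma prod_ffun_tuple (A : comNzRingType) (T : finType) k (F : seq T -> A) :
  \prod_(s : {ffun 'I_k -> T}) F [tuple s i | i < k] = \prod_(t : k.-tuple T) F t.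
Proof.
rewrite (reindex (fun s : {ffun 'I_k -> T} => [tuple s i | i < k])) //=.
exists (fun t : k.-tuple T => [ffun i => tnth t i]) => u _.
  by apply/ffunP => i; rewrite ffunE tnth_mktuple.
by apply: eq_from_tnth => i; rewrite tnth_mktuple ffunE.
Qed.

(** * Walsh transform of the butterfly adjacency *)

Section Walsh.
Variables (A : comNzRingType) (k : nat).
Local Notation word := {ffun 'I_k -> bool}.
Implicit Types (w s : word) (c : 'I_k.+1).

Definition walsh w s : A := \prod_i (-1) ^+ (w i && s i).

(** Indexed by [nat], with default false, to serve as off-diagonal data of [tridiag_mx]. *)
Definition bit s (i : nat) : bool := nth false [tuple s j | j < k] i.

Lemma bitE s (i : 'I_k) : bit s i = s i.
Proof. by rewrite /bit -tnth_nth tnth_mktuple. Qed.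

Lemma walsh0 w : walsh w [ffun=> false] = 1.
Proof. by apply: big1 => i _; rewrite ffunE andbF. Qed.

Lemma flipbitK w i : flipbit (flipbit w i) i = w.
Proof. by apply/ffunP => j; rewrite !ffunE; case: eqP => // ->; rewrite negbK. Qed.

Lemma flipbit_neq w i : w != flipbit w i.
Proof.
by apply/eqP => /ffunP/(_ i); rewrite ffunE eqxx; case: (w i).
Qed.

Lemma flipbit_eq w w' i : (w == flipbit w' i) = (w' == flipbit w i).
Proof. by apply/eqP/eqP => ->; rewrite flipbitK. Qed.

Lemma walsh_flip w s i : walsh (flipbit w i) s = (-1) ^+ s i * walsh w s.
Proof.
rewrite /walsh (bigD1 i) //= [in RHS](bigD1 i) //= mulrA ffunE eqxx; congr (_ * _).
  by case: (w i); case: (s i); rewrite /= ?expr1 ?expr0 ?mulr1 ?mulrNN ?mul1r.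
by apply: eq_bigr => j /negPf ji; rewrite ffunE ji.
Qed.

(** The sum factors over coordinates; one where the words differ contributes 1 - 1 = 0. *)
Lemma walsh_orthogonal w s :
  \sum_w' walsh w w' * walsh w' s = if w == s then 2 ^+ k else 0.
Proof.
pose f i b : A := (-1) ^+ (w i && b) * (-1) ^+ (b && s i).
transitivity (\prod_i \sum_b f i b).
  by rewrite bigA_distr_bigA; apply: eq_bigr => w' _; rewrite -big_split.
have [e|ne] := eqVneq w s.
  rewrite -[k in RHS](card_ord k) -prodr_const; apply: eq_bigr => i _.
  by rewrite big_bool /f e /= andbF andbT -expr2 sqrr_sign expr0 mulr1.
have [i ni] : exists i, w i != s i.
  apply/existsP; apply: contraR ne; rewrite negb_exists => /forallP h.
  by apply/eqP/ffunP => i; apply/eqP; move: (h i); rewrite negbK.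
rewrite (bigD1 i) //= big_bool /f /= andbF andbT expr0 mulr1.
by move: ni; case: (w i); case: (s i) => //= _;
  rewrite expr1 ?expr0 ?mulr1 ?mul1r addNr mul0r.
Qed.

Lemma sum_bfwd c c' w s :
  \sum_w' (bfwd (c, w) (c', w'))%:R * walsh w' s =
  if c' == c.+1 :> nat then (if bit s c then 0 else 2) * walsh w s else 0.
Proof.
rewrite /bfwd /=; case: eqP => [cc' | _]; last first.
  by rewrite big1 // => w' _; rewrite mul0r.
have ck : (c < k)%N by rewrite -ltnS -cc'.
pose i := Ordinal ck.
have e w' : [exists i0 : 'I_k, (val i0 == val c) && ((w' == w) || (w' == flipbit w i0))]
    = (w' == w) || (w' == flipbit w i).
  apply/existsP/idP => [[j /andP[/eqP jc]]|h]; last by exists i; rewrite eqxx.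
  by have -> : j = i by apply: val_inj.
under eq_bigr do rewrite e.
rewrite (bigD1 w) //= eqxx mul1r (bigD1 (flipbit w i)) /=; last first.
  by rewrite eq_sym flipbit_neq.
rewrite eqxx orbT mul1r big1 => [|w' /andP[/negPf -> /negPf ->]]; last by rewrite mul0r.
rewrite walsh_flip -[X in bit s X]/(val i) bitE addr0.
by case: (s i); rewrite ?expr1 ?expr0; ring.
Qed.

(** Flipping a bit is an involution, so exchanging the two words reduces this to [sum_bfwd]. *)
Lemma sum_bfwd_rev c c' w s :
  \sum_w' (bfwd (c', w') (c, w))%:R * walsh w' s =
  if c == c'.+1 :> nat then (if bit s c' then 0 else 2) * walsh w s else 0.
Proof.
have [e|/negPf ne] := eqVneq (c : nat) c'.+1.
  have e' w' : bfwd (c', w') (c, w) = bfwd (c', w) (c, w').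
    rewrite /bfwd /=; congr (_ && _); apply: eq_existsb => i.
    by rewrite (eq_sym w) flipbit_eq.
  by under eq_bigr do rewrite e'; rewrite sum_bfwd e eqxx.
by rewrite big1 // => w' _; rewrite /bfwd /= ne mul0r.
Qed.

(** Forward edges in both directions would put a column two past itself, so the disjunction is a
    sum. *)
Lemma badj_natr (u v : bvert k) : (badj u v)%:R = (bfwd u v)%:R + (bfwd v u)%:R :> A.
Proof.
rewrite /badj /bfwd; case: eqP => [-> |_] /=; last by rewrite add0r.
by rewrite -[X in _ + (X && _)%:R]/(val u.1 == (val u.1).+2) ltn_eqF // orbF addr0.
Qed.

Lemma sum_badj c c' w s :
  \sum_w' (badj (c, w) (c', w'))%:R * walsh w' s =
  (if c' == c.+1 :> nat then (if bit s c then 0 else 2)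
   else if c == c'.+1 :> nat then (if bit s c' then 0 else 2) else 0) * walsh w s.
Proof.
under eq_bigr do rewrite badj_natr mulrDl.
rewrite big_split /= sum_bfwd sum_bfwd_rev.
case: eqP => [->|_]; first by rewrite ltn_eqF // addr0.
by case: ifP => _; rewrite add0r ?mul0r.
Qed.

(** The degree is the adjacency sum against the trivial character s = 0: two neighbours per adjacent
    column. *)
Lemma bdegE (u : bvert k) :
  (bdeg u)%:R = 4 - (if u.1 == 0%N :> nat then 2 else 0)
                  - (if u.1 == k :> nat then 2 else 0) :> A.
Proof.
case: u => c w /=; rewrite /bdeg -sum1_card natr_sum.
under eq_bigl do rewrite inE.
rewrite big_mkcond -(pair_bigA _ (fun c' w' =>
  if badj (c, w) (c', w') then 1 else 0)) /=.
pose f (c' : nat) : A :=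
  (if c' == c.+1 then 2 else 0) + (if c == c'.+1 :> nat then 2 else 0).
have b0 j : bit [ffun=> false] j = false.
  rewrite /bit; have [jk|kj] := ltnP j k; last by rewrite nth_default // size_tuple.
  by rewrite -[j]/(val (Ordinal jk)) -tnth_nth tnth_mktuple ffunE.
transitivity (\sum_(c' < k.+1) f c').
  apply: eq_bigr => c' _.
  transitivity (\sum_w' (badj (c, w) (c', w'))%:R * walsh w' [ffun=> false]).
    by apply: eq_bigr => w' _; rewrite walsh0 mulr1; case: ifP.
  rewrite sum_badj walsh0 mulr1 !b0 /f.
  by case: eqP => [->|_]; rewrite ?add0r // ltn_eqF // addr0.
rewrite big_split /=.
have -> : \sum_(c' < k.+1) (if c' == c.+1 :> nat then 2 else 0) =
    (if c == k :> nat then 0 else 2) :> A.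
  have [ck|/negPf ck] := eqVneq (c : nat) k.
    by rewrite big1 // => c' _; rewrite ck ltn_eqF.
  have lt : (c.+1 < k.+1)%N by rewrite ltnS ltn_neqAle ck -ltnS ltn_ord.
  rewrite (bigD1 (Ordinal lt)) //= eqxx big1 ?addr0 // => c' /negPf.
  by rewrite -val_eqE /= => ->.
have -> : \sum_(c' < k.+1) (if c == c'.+1 :> nat then 2 else 0) =
    (if c == 0%N :> nat then 0 else 2) :> A.
  have [c0|c0] := eqVneq (c : nat) 0%N; first by rewrite big1 // => c' _; rewrite c0.
  have lt : (c.-1 < k.+1)%N by rewrite (leq_ltn_trans (leq_pred _)) ?ltn_ord.
  rewrite (bigD1 (Ordinal lt)) //= prednK ?lt0n // eqxx big1 ?addr0 // => c' /negPf.
  rewrite -val_eqE /= => ne; case: eqP => // e; move: ne.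
  by rewrite e /= eqxx.
by case: ifP => _; case: ifP => _; ring.
Qed.

End Walsh.

(** With M the matrix of X - L, H the Walsh transform and B the direct sum of the tridiagonal
    blocks, M H = H B. Taking determinants and cancelling that of H avoids inverting H over
    polynomials. *)
Lemma char_poly_blaplacian (R : realType) k :
  char_poly (blaplacian R k) =
  \prod_(s : {ffun 'I_k -> bool}) \det (tridiag_mx k.+1
     (fun i => (if i == 0%N then 'X - 2 else 'X - 4) +
        (if i == k then 2 else 0) : {poly R})
     (fun i => if bit s i then 0 else 2)).
Proof.
set D := (fun i : nat => _ + _ : {poly R}).
pose M (u v : bvert k) : {poly R} := (if u == v then D u.1 else 0) + (badj u v)%:R.
pose H (u v : bvert k) : {poly R} := if u.1 == v.1 then walsh _ u.2 v.2 else 0.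
pose B (s : {ffun 'I_k -> bool}) := tridiag_mx k.+1 D (fun i => if bit s i then 0 else 2).
have -> : char_poly (blaplacian R k) = fdet M.
  congr (\det _); apply/matrixP => i j; rewrite !mxE /= /M !(inj_eq enum_val_inj).
  rewrite raddfB /= rmorph_nat opprB addrCA addrC; congr (_ + _).
  case: eqP => _; last by rewrite polyC0 mulr0n subr0.
  rewrite mulr1n rmorph_nat bdegE /D.
  by case: ifP => _; case: ifP => _; ring.
rewrite -fdet_block.
(* H squared is 2^k times the identity. *)
have HH : fdet H * fdet H != 0.
  rewrite -fdet_mul (@eq_fdet _ _ _ (fun u v => if u == v then 2 ^+ k else 0)).
    by rewrite fdet_scalar !expf_neq0 // -polyC_natr polyC_eq0 pnatr_eq0.
  move=> [c w] [c' s]; rewrite /H /=.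
  rewrite -(pair_bigA _ (fun c1 w1 => (if c == c1 then walsh _ w w1 else 0) *
     (if c1 == c' then walsh _ w1 s else 0))) /=.
  rewrite (bigD1 c) //= eqxx [X in _ + X]big1 ?addr0 => [|c1 /negPf cc1]; last first.
    by rewrite big1 // => w1 _; rewrite eq_sym cc1 mul0r.
  rewrite xpair_eqE; case: eqP => _ /=; first exact: walsh_orthogonal.
  by rewrite big1 // => w1 _; rewrite mulr0.
have H0 : fdet H != 0 by apply: contraNneq HH => ->; rewrite mul0r.
(* What remains is M H = H B, entry by entry. *)
apply: (mulIf H0); rewrite [RHS]mulrC -!fdet_mul; apply: eq_fdet => [[c w] [c' s]].
rewrite -(pair_bigA _ (fun c1 w1 => M (c, w) (c1, w1) * H (c1, w1) (c', s))) /=.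
rewrite -[RHS](pair_bigA _ (fun c1 w1 => H (c, w) (c1, w1) *
   (if w1 == s then B w1 c1 c' else 0))) /=.
rewrite (bigD1 c') //= [X in _ + X]big1 ?addr0 => [|c1 /negPf cc1]; last first.
  by rewrite big1 // => w1 _; rewrite /H /= cc1 mulr0.
rewrite [RHS](bigD1 c) //= [X in _ = _ + X]big1 ?addr0 => [|c1 /negPf cc1]; last first.
  by rewrite big1 // => w1 _; rewrite /H /= eq_sym cc1 mul0r.
rewrite [RHS](bigD1 s) //= [X in _ = _ + X]big1 ?addr0 => [|w1 /negPf ws]; last first.
  by rewrite ws mulr0.
rewrite !eqxx /H /= !eqxx /M.
under eq_bigr do rewrite mulrDl.
rewrite big_split /= sum_badj mxE.
rewrite (bigD1 w) //= [X in _ + X + _]big1 ?addr0 => [|w1 /negPf ww]; last first.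
  by rewrite xpair_eqE (eq_sym w) ww andbF mul0r.
rewrite xpair_eqE eqxx andbT -val_eqE /= [RHS]mulrC.
case: eqP => [->|_]; last by rewrite mul0r add0r.
by rewrite ltn_eqF // mul0r addr0.
Qed.

(** * Matching the factors with the listed spectrum *)

Lemma prod_flatten_nseq (A : comNzRingType) (T : Type) (F : T -> A)
    (f : nat -> nat -> T) (e : nat -> nat) (r : nat -> seq nat) (s : seq nat) :
  \prod_(z <- flatten [seq flatten [seq nseq (e i) (f i j) | j <- r i] | i <- s]) F z
  = \prod_(i <- s) (\prod_(j <- r i) F (f i j)) ^+ e i.
Proof.
rewrite big_flatten big_map; apply: eq_bigr => i _.
rewrite big_flatten big_map -prodrXl; apply: eq_bigr => j _.
by rewrite big_nseq; elim: (e i) => [|n IH]; rewrite ?expr0 //= IH exprS.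
Qed.

Lemma prod_iota1 (A : comNzRingType) (F : nat -> A) n :
  \prod_(i <- iota 1 n) F i = \prod_(0 <= t < n) F t.+1.
Proof. by rewrite (iotaDl 1 0) big_map /index_iota subn0. Qed.

Theorem theoremA1 (R : realType) (k : nat) (hk : (1 <= k)%N) :
  char_poly (blaplacian R k) = \prod_(x <- bspec R k) ('X - x%:P).
Proof.
rewrite char_poly_blaplacian.
pose F (t : seq bool) : {poly R} := path_end (foldr (path_step 'X) ('X - 2, 1) t).
transitivity (path_prod 'X k ('X - 2 : {poly R}, 1)).
  rewrite /path_prod -(prod_ffun_tuple _ F); apply: eq_bigr => s _.
  by rewrite /F -det_tridiag_path_end size_tuple.
rewrite path_prod_all /bspec !big_cat big_map !prod_flatten_nseq /= -mulrA.
congr (_ * (_ * _)); first exact: path_seq_factor_full.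
  rewrite prod_iota1; apply: eq_big_nat => t /andP[_ tk].
  rewrite -path_seq_factor_end; congr (_ ^+ _).
  by rewrite addn1 expnS mul2n.
(* The last U factor has exponent 0, and the third list of [bspec] stops just before it. *)
case: k hk {F} => // k _; rewrite prod_iota1 subn1 big_nat_recr // -[RHS]mulr1.
congr (_ * _); last by rewrite subnn mul0n expr0.
apply: eq_big_nat => t /andP[_ tk].
rewrite -path_seq_factor_mid; congr (_ ^+ (_ * 2 ^ _)).
by lia.
Qed.
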